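(* Let $G$ be a finite group, $p$ a prime and $P$ a Sylow $p$-subgroup of $G$. Suppose that property (WIRC-Syl) holds for the pair $(G,N_G(P))$. Then $M_l(G)=M_l(N_G(P))$ for every integer $l$ coprime to $p$ (that is, the Isaacs–Navarro conjecture holds for $G$ and $p$).
   Context: For a finite group $X$, $\operatorname{Irr}(X)$ is the set of complex irreducible characters, $\mathcal C(X)=\mathbb Z\operatorname{Irr}(X)$, $\operatorname{Irr}_{p'}(X)$ is the set of $\chi\in\operatorname{Irr}(X)$ with $p\nmid\chi(1)$, $\operatorname{Irr}^p(X)=\{\chi\in\operatorname{Irr}(X)\mid \chi(1)\equiv 0 \bmod p\}$ and $\mathcal C^p(X)=\mathbb Z\operatorname{Irr}^p(X)$. For an integer $l$, $M_l(X)=|\{\chi\in\operatorname{Irr}(X)\mid \chi(1)\equiv\pm l \bmod p\}|$. For a set $S$ of virtual characters, $\pm S=\{\chi,-\chi\mid\chi\in S\}$; a bijection $F\colon\pm S_1\to\pm S_2$ is signed if $F(-\chi)=-F(\chi)$ for all $\chi\in \pm S_1$. Write ${}^tP=tPt^{-1}$. For a $p$-subgroup $P$ of $G$ and $H\le G$, $\mathcal S(G,P,H)=\{Q\le P\mid Q\subseteq{}^tP\text{ for some }t\in G\setminus H\}$. If $\mathcal S$ is a family of subgroups of $P$ closed under taking subgroups, and $X$ is a finite group containing $P$, $\mathcal I(X,P,\mathcal S)$ is the subgroup of $\mathcal C(X)$ spanned by all $\operatorname{Ind}_L^X\phi$ with $\phi\in\mathcal C(L)$ and $L\le X$ such that $L\cap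 P$ is a Sylow $p$-subgroup of $L$ and $L\cap P\in\mathcal S$. Property (WIRC-Syl) for $(G,H)$, where $P$ is a Sylow $p$-subgroup of $G$ and $N_G(P)\le H\le G$: there is a signed bijection $F\colon\pm\operatorname{Irr}_{p'}(G)\to\pm\operatorname{Irr}_{p'}(H)$ such that $F(\chi)\equiv\operatorname{Res}^G_H\chi \bmod \mathcal C^p(H)+\mathcal I(H,P,\mathcal S(G,P,H))$ for all $\chi\in\pm\operatorname{Irr}_{p'}(G)$. *)

(* Defs.v *)
From mathcomp Require Import all_boot all_order all_algebra all_fingroup.
From mathcomp Require Import all_solvable all_field all_character.

Set Implicit Arguments.
Unset Strict Implicit.
Unset Printing Implicit Defensive.
Import Order.TTheory GRing.Theory Num.Theory.
Local Open Scope group_scope.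
Local Open Scope ring_scope.

(* [C(X)] is the library's ['Z[irr X]].  Degrees ['chi_i 1%g] live in [algC];
   divisibility and congruence of degrees are those of [C_scope], i.e. taken
   in the rational integers. *)

Section Families.

Variable gT : finGroupType.
Implicit Types (G H P L X : {group gT}) (p : nat).

Definition irr_p' p X : seq 'CF(X) :=
  [seq chi : 'CF(X) <- irr X | ~~ (p %| chi 1%g)%C].

Definition irr_p p X : seq 'CF(X) :=
  [seq chi : 'CF(X) <- irr X | (p %| chi 1%g)%C].

Definition pm X (S : seq 'CF(X)) : {pred 'CF(X)} :=
  [pred chi | (chi \in S) || (- chi \in S)].

Definition Mdeg p (l : int) X : nat :=
  #|[set i : Iirr X |
      ('chi_i 1%g == l %[mod p])%C || ('chi_i 1%g == (- l)%R %[mod p])%C]|.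

(* The conjugate tPt^-1 is [P :^ t^-1], since [A :^ x] is x^-1 A x. *)
Definition Sfam G P H : {set {group gT}} :=
  [set Q : {group gT} |
    (Q \subset P) && [exists t in G :\: H, (Q \subset P :^ t^-1)%g]].

(* Generators of [I(X, P, S)]. *)
Definition Igen p X P (S : {set {group gT}}) (psi : 'CF(X)) : Prop :=
  exists L : {group gT}, exists2 phi : 'CF(L),
    [/\ L \subset X, p.-Sylow(L) (L :&: P)%G & (L :&: P)%G \in S]
    & phi \in 'Z[irr L] /\ psi = 'Ind[X] phi.

End Families.

Inductive zspan (V : zmodType) (A : V -> Prop) : V -> Prop :=
| zspan_gen v of A v : zspan A v
| zspan_0 : zspan A 0
| zspan_sub u v of zspan A u & zspan A v : zspan A (u - v).

Definition Isub (gT : finGroupType) (p : nat) (X P : {group gT})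
    (S : {set {group gT}}) : 'CF(X) -> Prop :=
  zspan (@Igen gT p X P S).

Definition bij_between (aT rT : Type) (A : {pred aT}) (B : {pred rT})
    (F : aT -> rT) : Prop :=
  [/\ {in A, forall x, F x \in B},
      {in A &, injective F}
    & {in B, forall y, exists2 x, x \in A & F x = y}].

(* Meant for [P] a Sylow [p]-subgroup of [G] and ['N_G(P) \subset H] and
   [H \subset G].  Only the values of [F] on [pm (irr_p' p G)] matter. *)
Definition WIRC_Syl (gT : finGroupType) (p : nat) (G P H : {group gT}) : Prop :=
  exists F : 'CF(G) -> 'CF(H),
    [/\ bij_between (pm (irr_p' p G)) (pm (irr_p' p H)) F,
        {in pm (irr_p' p G), forall chi, F (- chi) = - F chi}
      & {in pm (irr_p' p G), forall chi,
          exists alpha beta : 'CF(H),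
            [/\ alpha \in 'Z[irr_p p H],
                Isub p P (Sfam G P H) beta
              & F chi - 'Res[H] chi = alpha + beta]}].

(* Main.v *)
Require Import Defs.
From mathcomp Require Import all_boot all_order all_algebra all_fingroup.
From mathcomp Require Import all_solvable all_field all_character.

(** Degrees modulo [p] do not see the error terms of (WIRC-Syl).  Members of
    [C^p(H)] have degree divisible by [p] by definition.  A generator
    [Ind_L^H phi] of [I(H, P, S(G, P, H))] has degree [|H : L| phi(1)], and [p]
    divides [|H : L|]: otherwise the Sylow subgroup [L :&: P] of [L] would have
    the order of [P], so [P] itself would lie in [S(G, P, H)], and the [t]
    outside [H] with [P <= tPt^-1] would normalise [P], although [N_G(P) <= H]
    ([Sfam_proper], [Igen_degree]).  Hence [F(chi)(1) = chi(1)] modulo [p].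

    A signed bijection that preserves degrees modulo [p] induces, on forgetting
    signs, a bijection between the irreducible characters of [p']-degree that
    preserves the class of the degree modulo [p] up to sign, and these classes
    are exactly what the numbers [M_l] count ([Mdeg_signed_bij]).  The argument
    applies to every [H] between [N_G(P)] and [G] ([WIRC_Syl_Mdeg]). *)

Section DegreesModP.

Set Implicit Arguments.
Unset Strict Implicit.
Unset Printing Implicit Defensive.

Import GRing.Theory Num.Theory.
Local Open Scope group_scope.
Local Open Scope ring_scope.

(** Congruence of the degree to [l] or [-l], as a predicate on all class
    functions so that it can be tested on both [chi] and [- chi]. *)
Definition degree_pm (p : nat) (l : int) {gT : finGroupType} {X : {group gT}}
    (chi : 'CF(X)) : bool :=
  (chi 1%g == l%:~R %[mod p])%C || (chi 1%g == (- l)%:~R %[mod p])%C.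

Lemma MdegE (p : nat) (l : int) (gT : finGroupType) (X : {group gT}) :
  Mdeg p l X = #|[set i : Iirr X | degree_pm p l 'chi_i]|.
Proof. by apply: eq_card => i; rewrite !inE. Qed.

Lemma degree_pmN (p : nat) (l : int) (gT : finGroupType) (X : {group gT})
    (chi : 'CF(X)) :
  degree_pm p l (- chi) = degree_pm p l chi.
Proof. by rewrite /degree_pm cfunE !eqCmodN rmorphN opprK orbC. Qed.

Lemma eq_degree_pm (p : nat) (l : int) (gT rT : finGroupType)
    (X : {group gT}) (Y : {group rT}) (chi : 'CF(X)) (psi : 'CF(Y)) :
  (psi 1%g == chi 1%g %[mod p])%C -> degree_pm p l psi = degree_pm p l chi.
Proof. by move=> eq_mod; rewrite /degree_pm !(eqCmod_transl _ eq_mod). Qed.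

Lemma degree_pm_irr_p' (p : nat) (l : int) (gT : finGroupType)
    (X : {group gT}) (i : Iirr X) :
    prime p -> coprimez l p -> degree_pm p l 'chi_i ->
  'chi_i \in irr_p' p X.
Proof.
move=> p_pr co_lp deg_i; rewrite mem_filter mem_irr andbT.
apply: contraL deg_i => p_dv_i.
have p_ndv_l: ~~ (p %| l%:~R)%C.
  rewrite dvdC_int ?intr_int // intrKfloor -prime_coprime //.
  by move: co_lp; rewrite coprimez_sym.
rewrite -eqCmod0 in p_dv_i; rewrite /degree_pm !(eqCmod_transl _ p_dv_i).
by rewrite !(eqCmod_sym _ 0) !eqCmod0 rmorphN rpredN orbb.
Qed.

Lemma irr_neqN (gT : finGroupType) (X : {group gT}) (i j : Iirr X) :
  'chi_i != - 'chi_j.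
Proof.
apply/eqP=> /cfunP/(_ 1%g)/eqP.
rewrite cfunE -addr_eq0 => /eqP sum0.
have:= addr_gt0 (irr1_gt0 i) (irr1_gt0 j).
by rewrite sum0 Order.POrderTheory.ltxx.
Qed.

(** Forgets the sign of a signed irreducible character; other class functions
    get a default index. *)
Definition abs_irr {gT : finGroupType} {X : {group gT}} (psi : 'CF(X)) :
    Iirr X :=
  cfIirr (if psi \in irr X then psi else - psi).

Lemma abs_irrE (gT : finGroupType) (X : {group gT}) (i : Iirr X) :
  abs_irr 'chi_i = i.
Proof. by apply: irr_inj; rewrite /abs_irr mem_irr cfIirrE ?mem_irr. Qed.

Lemma abs_irrN (gT : finGroupType) (X : {group gT}) (i : Iirr X) :
  abs_irr (- 'chi_i) = i.
Proof.
rewrite /abs_irr; case: ifP => [/irrP[j eq_Ni_j]|_].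
  by have:= irr_neqN j i; rewrite -eq_Ni_j eqxx.
by rewrite opprK; apply: irr_inj; rewrite cfIirrE ?mem_irr.
Qed.

Lemma pm_abs_irr (p : nat) (gT : finGroupType) (X : {group gT})
    (psi : 'CF(X)) :
    psi \in pm (irr_p' p X) ->
  'chi_(abs_irr psi) \in irr_p' p X
  /\ (psi = 'chi_(abs_irr psi) \/ psi = - 'chi_(abs_irr psi)).
Proof.
have irr_p'P chi : chi \in irr_p' p X -> exists i, chi = 'chi_i.
  by rewrite mem_filter => /andP[_ /irrP].
case/orP=> p'psi; have [i def_i] := irr_p'P _ p'psi.
  by rewrite def_i abs_irrE -def_i; split; last left.
have ->: psi = - 'chi_i by rewrite -def_i opprK.
by rewrite abs_irrN -def_i; split; last right.
Qed.

(** Signs can be forgotten on both sides: [F] sends the two elements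
    [chi, - chi] above an irreducible character to two opposite ones, so
    [i |-> abs_irr (F 'chi_i)] is again injective and surjective. *)
Lemma Mdeg_signed_bij (p : nat) (l : int) (gT rT : finGroupType)
    (X : {group gT}) (Y : {group rT}) (F : 'CF(X) -> 'CF(Y)) :
    prime p -> coprimez l p ->
    bij_between (pm (irr_p' p X)) (pm (irr_p' p Y)) F ->
    {in pm (irr_p' p X), forall chi, F (- chi) = - F chi} ->
    {in pm (irr_p' p X), forall chi, (F chi 1%g == chi 1%g %[mod p])%C} ->
  Mdeg p l X = Mdeg p l Y.
Proof.
move=> p_pr co_lp [F_pm F_inj F_surj] F_sign F_deg.
pose g i := abs_irr (F 'chi_i).
have pm_irr i : 'chi_i \in irr_p' p X -> 'chi_i \in pm (irr_p' p X).
  by rewrite inE => ->.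
have pmN i : 'chi_i \in irr_p' p X -> - 'chi_i \in pm (irr_p' p X).
  by rewrite inE opprK orbC => ->.
have gP i : 'chi_i \in irr_p' p X ->
    F 'chi_i = 'chi_(g i) \/ F 'chi_i = - 'chi_(g i).
  by move/pm_irr/F_pm/pm_abs_irr=> [].
have deg_g i : 'chi_i \in irr_p' p X ->
    degree_pm p l 'chi_(g i) = degree_pm p l 'chi_i.
  move=> p'i; rewrite -(eq_degree_pm _ (F_deg _ (pm_irr i p'i))).
  by case: (gP i p'i) => ->; rewrite ?degree_pmN.
pose A := [set i : Iirr X | degree_pm p l 'chi_i].
have p'A i : i \in A -> 'chi_i \in irr_p' p X.
  by rewrite inE; apply: degree_pm_irr_p'.
have g_inj : {in A &, injective g}.
  move=> i j /p'A p'i /p'A p'j eq_g.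
  have [eqF | eqF] : F 'chi_i = F 'chi_j \/ F 'chi_i = F (- 'chi_j).
    rewrite F_sign ?pm_irr //.
    by case: (gP i p'i) => ->; case: (gP j p'j) => ->; rewrite eq_g ?opprK; auto.
  - by apply: irr_inj; apply: F_inj; rewrite ?pm_irr.
  - have /eqP := F_inj _ _ (pm_irr i p'i) (pmN j p'j) eqF.
    by rewrite (negPf (irr_neqN i j)).
rewrite !MdegE -(card_in_imset g_inj).
apply: eq_card => k; apply/imsetP/idP => [[i Ai ->] | ].
  by have:= Ai; rewrite !inE -deg_g ?p'A.
rewrite inE => deg_k.
have p'k := degree_pm_irr_p' p_pr co_lp deg_k.
have [|chi pm_chi def_k] := F_surj 'chi_k; first by rewrite inE p'k.
have [p'i chi_i] := pm_abs_irr pm_chi.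
move: (abs_irr chi) p'i chi_i => i p'i chi_i.
have gi : g i = k.
  have [Fi | Fi] : F 'chi_i = 'chi_k \/ F 'chi_i = - 'chi_k.
  - case: chi_i => def_chi; move: def_k; rewrite def_chi; first by left.
    by rewrite F_sign ?pm_irr // => <-; rewrite opprK; right.
  - by rewrite /g Fi abs_irrE.
  - by rewrite /g Fi abs_irrN.
by exists i; rewrite // inE -deg_g // gi.
Qed.

(** If [Q = P], the [t] outside [H] with [P <= tPt^-1] would normalise [P]. *)
Lemma Sfam_proper (gT : finGroupType) (G P H Q : {group gT}) :
  'N_G(P)%g \subset H -> Q \in Sfam G P H -> Q \proper P.
Proof.
move=> sNH; rewrite inE properE => /andP[-> /exists_inP[t]].
rewrite inE => /andP[notHt Gt] sQPt; apply: contra notHt => sPQ.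
apply: (subsetP sNH); rewrite inE Gt inE sub_conjg.
exact: subset_trans sPQ sQPt.
Qed.

(** The degree is [|H : L| phi(1)], and an index [|H : L|] prime to [p] would
    make the Sylow subgroup [L :&: P] of [L] as large as [P]. *)
Lemma Igen_degree (p : nat) (gT : finGroupType) (G P H : {group gT})
    (psi : 'CF(H)) :
    prime p -> p.-Sylow(H) P -> 'N_G(P)%g \subset H ->
    Igen p P (Sfam G P H) psi ->
  (p %| psi 1%g)%C.
Proof.
move=> p_pr sylP sNH [L [phi [sLH sylQ SQ] [Zphi ->]]].
have ltQP := Sfam_proper sNH SQ.
rewrite cfInd1 //; apply: dvdC_mulr; first exact: Cint_vchar1.
rewrite (dvdC_nat p); apply: contraLR ltQP; rewrite -p'natE // => p'HL.
rewrite properEcard negb_and -leqNgt (card_Hall sylQ) (card_Hall sylP).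
by rewrite -(Lagrange sLH) partnM // (part_p'nat p'HL) muln1 leqnn orbT.
Qed.

Lemma zspan_degree (p : nat) (gT : finGroupType) (X : {group gT})
    (A : 'CF(X) -> Prop) (psi : 'CF(X)) :
    (forall chi, A chi -> (p %| chi 1%g)%C) -> zspan A psi ->
  (p %| psi 1%g)%C.
Proof.
move=> degA; elim=> [chi /degA // | | chi1 chi2 _ dv1 _ dv2].
  by rewrite cfunE rpred0.
by rewrite !cfunE rpredB.
Qed.

Lemma zchar_irr_p_degree (p : nat) (gT : finGroupType) (X : {group gT})
    (alpha : 'CF(X)) :
  alpha \in 'Z[irr_p p X] -> (p %| alpha 1%g)%C.
Proof.
case/zchar_nth_expansion=> z Zz ->; rewrite sum_cfunE rpred_sum // => i _.
rewrite cfunE dvdC_mull //.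
by have:= mem_nth 0 (ltn_ord i); rewrite mem_filter => /andP[].
Qed.

Lemma WIRC_Syl_Mdeg (gT : finGroupType) (G P H : {group gT}) (p : nat)
    (l : int) :
    prime p -> p.-Sylow(G) P -> 'N_G(P)%g \subset H -> H \subset G ->
    WIRC_Syl p G P H -> coprimez l p ->
  Mdeg p l G = Mdeg p l H.
Proof.
move=> p_pr sylP sNH sHG [F [F_bij F_sign F_cong]] co_lp.
have sylPH : p.-Sylow(H) P.
  apply: (pHall_subl _ sHG sylP); apply: subset_trans sNH.
  by rewrite subsetI (pHall_sub sylP) normG.
apply: (Mdeg_signed_bij p_pr co_lp F_bij F_sign) => chi /F_cong.
move=> [alpha [beta [Zalpha Ibeta /cfunP/(_ 1%g)]]].
rewrite !cfunE cfResE // => def_diff.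
rewrite /eqCmod def_diff rpredD ?(zchar_irr_p_degree Zalpha) //.
by apply: zspan_degree Ibeta => psi; apply: Igen_degree.
Qed.

End DegreesModP.

Local Open Scope group_scope.

Theorem proposition1p7 (gT : finGroupType) (G P : {group gT}) (p : nat)
    (p_pr : prime p) (sylP : p.-Sylow(G) P)
    (wirc : WIRC_Syl p G P 'N_G(P)%G) :
  forall l : int, coprimez l p -> Mdeg p l G = Mdeg p l 'N_G(P)%G.
Proof.
by move=> l; apply: WIRC_Syl_Mdeg wirc; rewrite ?subxx ?subsetIl.
Qed.
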